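(* Let $\Gamma=(E,\sim,\sigma_1,\sigma_0)$ be a fat graph with two standard cycles $\alpha=(x_1,\dots,x_n)$ and $\beta=(y_1,\dots,y_n)$. The cycle $\alpha$ is separating if and only if, for every $i=1,\dots,n$, the directed edges $y_i$ and $y_i^{-1}$ are in the same column of the normal matrix $M(\alpha,\beta)$.
   Context: A graph is a triple $(E,\sim,\sigma_1)$ where $E$ is a finite non-empty set (directed edges), $\sim$ is an equivalence relation on $E$ (its classes are the vertices; $\vec e\sim\vec e\,'$ means same initial vertex), and $\sigma_1:E\to E$ is a fixed-point-free involution (edge reversal); write $x^{-1}=\sigma_1(x)$. A fat graph is a quadruple $(E,\sim,\sigma_1,\sigma_0)$ where $(E,\sim,\sigma_1)$ is a graph and $\sigma_0$ is a permutation of $E$ each of whose cycles is a cyclic order on the set of directed edges going out of a vertex (one cycle per vertex). It is decorated if each vertex has even degree at least $4$. A standard cycle in a decorated fat graph is a simple cycle in which any two consecutive edges are opposite to each other in the cyclic order at their common vertex. Here $\Gamma$ is decorated and is the edge-disjoint union of its two standard cycles, so $E=\{x_i,x_i^{-1},y_i,y_i^{-1}: i=1,\dots,n\}$, there are $n$ vertices, each of degree $4$, and each is a crossing of $\alpha$ with $\beta$. The surface $\Sigma(\Gamma)$ is the oriented surface with boundary obtained by taking a disk for each vertex and a rectangular strip for each undirected edge, gluing the strips to the disks according to the cyclic orders given by $\sigma_0$. Capping each boundary component of $\Sigma(\Gamma)$ with a disk yields a closed oriented surface $S$; the standard cycles give simple closed curves on $S$, still denoted $\alpha,\beta$. The cycle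 $\alpha$ is called separating if $S\setminus\alpha$ is disconnected. The normal matrix $M(\alpha,\beta)$ is the $n\times 4$ matrix whose $i$-th row is the cycle of $\sigma_0$ at the initial vertex of $x_i$, written starting with $x_i$, i.e. $(x_i,\sigma_0(x_i),\sigma_0^2(x_i),\sigma_0^3(x_i))$. Thus the third entry of row $i$ is $x_{i-1}^{-1}$ (indices modulo $n$) and the second and fourth columns consist of the directed edges $y_j^{\pm1}$. *)

(* Defs.v *)
From HB Require Import structures.
From Stdlib Require Import Relation_Operators.
From mathcomp Require Import all_boot all_order all_algebra all_fingroup.
From mathcomp Require Import all_classical all_reals all_analysis.

Set Implicit Arguments.
Unset Strict Implicit.
Unset Printing Implicit Defensive.

Import Order.TTheory GRing.Theory Num.Theory.
Import numFieldNormedType.Exports.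

Local Open Scope classical_set_scope.
Local Open Scope ring_scope.
Local Open Scope quotient_scope.

Record graph := Graph {
  dedge :> finType;
  dedge_nonempty : (0 < #|dedge|)%N;
  sim : rel dedge;
  sim_equiv : equivalence_rel sim;
  erev : dedge -> dedge;
  erevK : involutive erev;
  erev_neq : forall e, erev e != e }.

Record fatgraph := FatGraph {
  fgraph :> graph;
  vrot : {perm fgraph};
  vrot_sim : forall e e' : fgraph, sim e e' = fconnect vrot e e' }.

Section FatGraphs.
Variable G : fatgraph.
Implicit Types e : G.

Definition degree e : nat := #|[pred e' | sim e e']|.

Definition decorated : Prop := forall e, ~~ odd (degree e) /\ (4 <= degree e)%N.

Definition opposite e e' : Prop :=
  sim e e' /\ e' = iter (degree e)./2 (@vrot G) e.

Section Cycles.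
Variable n : nat.
Implicit Types x y : 'I_n -> G.

Definition simple_cycle x : Prop :=
  [/\ (0 < n)%N,
      forall i, sim (erev (x i)) (x (ordS i)),
      forall i j, sim (x i) (x j) -> i = j
    & forall i j, x j <> erev (x i)].

Definition standard_cycle x : Prop :=
  simple_cycle x /\ forall i, opposite (erev (x i)) (x (ordS i)).

Definition on_cycle x e : Prop := exists i, e = x i \/ e = erev (x i).

Definition edge_disjoint_union x y : Prop :=
  (forall e, on_cycle x e \/ on_cycle y e) /\
  (forall e, ~ (on_cycle x e /\ on_cycle y e)).

(* Rows and columns are numbered from 0. *)
Definition normal_matrix x : 'M[G]_(n, 4) :=
  \matrix_(i < n, j < 4) iter j (@vrot G) (x i).

End Cycles.

End FatGraphs.

Definition in_column (T : Type) m n (M : 'M[T]_(m, n)) (j : 'I_n) (a : T) :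
  Prop := exists i, M i j = a.

(* The cycles of a permutation f, each named by its canonical element, and the
   position of an element in its cycle, counted from the canonical element. *)
Section Orbits.
Variables (T : finType) (f : T -> T).

Definition cyc := {e : T | froots f e}.

Definition cyc_of (f_inj : injective f) (e : T) : cyc :=
  exist _ (froot f e) (roots_root (fconnect_sym f_inj) e).

Definition cyc_pos (e : T) : nat := findex f (froot f e) e.

End Orbits.

Section Surface.
Variables (R : realType) (G : fatgraph).
Implicit Types (e : G) (r s t u : R).

(* Walking along e with the boundary of the ribbon surface on the right, then
   counterclockwise around the disk at the end of e, one next meets
   the strip of vrot (erev e): boundary components are the cycles of bnd. *)
Definition bnd e : G := vrot G (erev e).

Lemma erev_inj : injective (@erev G).
Proof. exact: inv_inj (@erevK G). Qed.

Lemma bnd_inj : injective bnd.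
Proof. by move=> e e' /perm_inj /erev_inj. Qed.

Inductive piece :=
  | Disk of cyc (vrot G)     (* one for each vertex *)
  | Strip of cyc (@erev G)  (* one for each undirected edge *)
  | Cap of cyc bnd.         (* one for each boundary component *)

HB.instance Definition _ := gen_eqMixin piece.
HB.instance Definition _ := gen_choiceMixin piece.

Definition unit_disk : set (R * R) := [set p | p.1 ^+ 2 + p.2 ^+ 2 <= 1].

Definition rectangle : set (R * R) := `[0, 1] `*` `[-1, 1].

Definition piece_shape (c : piece) : set (R * R) :=
  if c is Strip _ then rectangle else unit_disk.

Definition piece_space (c : piece) : topologicalType := set_type (piece_shape c).

Definition pieces := {c : piece & piece_space c}.

HB.instance Definition _ := Topological.on pieces.

Definition raw (a : pieces) : piece * (R * R) :=
  (projT1 a, set_val (projT2 a)).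

Definition polar r t : R * R := (r * cos t, r * sin t).

(* The point of the disk at the initial vertex of e, at distance r from the
   centre and at angle t counterclockwise from the direction of e. The
   directions of the edges at a vertex of degree d are spaced by 2 pi / d,
   in the cyclic order given by vrot. *)
Definition disk_pt e r t : piece * (R * R) :=
  (Disk (cyc_of (@perm_inj _ (vrot G)) e),
   polar r (2 * pi * (cyc_pos (vrot G) e)%:R / (degree e)%:R + t)).

(* The point of the strip of e at longitudinal coordinate s, from 0 at the
   initial vertex of e to 1 at its terminal vertex, and transversal coordinate
   t, positive on the left of e: (e, s, t) and (erev e, 1 - s, - t) denote the
   same point. *)
Definition strip_pt e s t : piece * (R * R) :=
  (Strip (cyc_of erev_inj e),
   if froot (@erev G) e == e then (s, t) else (1 - s, - t)).

(* The boundary circle of a cap is divided into arcs, one for each directed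
   edge e of the corresponding cycle of bnd; u in [0, 1] runs through that arc,
   clockwise so that the gluing respects orientations. *)
Definition cap_pt e u : piece * (R * R) :=
  (Cap (cyc_of bnd_inj e),
   polar 1 (- (2 * pi * ((cyc_pos bnd e)%:R + u) / (fingraph.order bnd e)%:R))).

(* The short side of the strip at e is glued to the arc centred at the
   direction of e and of length pi / degree e; half of the boundary of the disk
   remains free. The arc of e on the boundary of a cap is glued first to the
   right side of the strip of e, and then to the free arc following erev e on
   the disk at the terminal vertex of e. *)
Inductive gluing : piece * (R * R) -> piece * (R * R) -> Prop :=
  | glue_strip_disk e t : -1 <= t <= 1 ->
      gluing (strip_pt e 0 t) (disk_pt e 1 (t * (pi / (2 * (degree e)%:R))))
  | glue_cap_strip e s : 0 <= s <= 1 ->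
      gluing (cap_pt e (s / 2)) (strip_pt e s (-1))
  | glue_cap_disk e s : 0 <= s <= 1 ->
      gluing (cap_pt e ((1 + s) / 2))
           (disk_pt (erev e) 1
              ((1 + 2 * s) * (pi / (2 * (degree (erev e))%:R)))).

Definition glue_rel (a b : pieces) : bool :=
  `[< clos_refl_sym_trans pieces (fun a b => gluing (raw a) (raw b)) a b >].

Lemma glue_rel_refl : reflexive glue_rel.
Proof. by move=> a; apply/asboolP; exact: rst_refl. Qed.

Lemma glue_rel_sym : symmetric glue_rel.
Proof. by move=> a b; apply/asboolP/asboolP; exact: rst_sym. Qed.

Lemma glue_rel_trans : transitive glue_rel.
Proof.
by move=> b a c /asboolP ab /asboolP bc; apply/asboolP; apply: rst_trans ab bc.
Qed.

Definition glue_equiv :=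
  EquivRel glue_rel glue_rel_refl glue_rel_sym glue_rel_trans.

Definition surface := {eq_quot glue_equiv}.

HB.instance Definition _ := Topological.copy surface (quotient_topology surface).
HB.instance Definition _ := Quotient.on surface.

Section Curve.
Variables (n : nat) (x : 'I_n -> G).

(* The middle line of each strip traversed by x, continued straight to the
   centres of the disks at both of its ends. *)
Definition core : set (piece * (R * R)) :=
  [set p | exists e s, [/\ on_cycle x e, 0 <= s <= 1 &
                           p = strip_pt e s 0 \/ p = disk_pt e s 0]].

Definition curve : set surface := \pi_surface @` (raw @^-1` core).

Definition separating : Prop := ~ connected (~` curve).

End Curve.

End Surface.

(* Main.v *)
(* Write L and R for the two sides of alpha. Every vertex has degree 4 and is
   passed once by each cycle, so an edge starting with y leaves alpha on the side
   given by its column of the normal matrix. The surface cut along alpha is made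
   of pieces (half-disks, half-strips, whole strips of beta, caps), each of them
   convex. If every edge of beta starts and ends on the same side, then each
   piece gets a side compatible with all gluings, and the points on the side L
   form a proper clopen set. Otherwise, walking along alpha links all half-disks
   on a given side to each other, some edge of beta links the two sides, and
   every other piece is glued to some half-disk, so the complement of alpha is
   connected. *)
From Stdlib Require Import Relation_Operators.
Require Import Defs.
From mathcomp Require Import all_boot all_order all_algebra perm.
From mathcomp Require Import all_classical all_reals all_analysis.
From mathcomp Require Import zify ring lra.

Set Implicit Arguments.
Unset Strict Implicit.
Unset Printing Implicit Defensive.

Import Order.TTheory GRing.Theory Num.Theory.
Import numFieldNormedType.Exports.

Local Open Scope classical_set_scope.
Local Open Scope ring_scope.
Local Open Scope quotient_scope.

(** * Convex sets in the plane and their connectedness *)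

Section PlaneTopology.
Variable R : realType.
Implicit Types (p q : R * R) (K : set (R * R)).

Definition between p q (t : R) : R * R :=
  (p.1 + t * (q.1 - p.1), p.2 + t * (q.2 - p.2)).

Definition convex K := forall p q t, K p -> K q -> 0 <= t <= 1 ->
  K (between p q t).

Lemma between_continuous p q : continuous (between p q).
Proof.
move=> t.
have aff (a b : R) : a + s * (b - a) @[s --> t] --> a + t * (b - a).
  by apply: cvgD; [exact: cvg_cst|apply: cvgM; [exact: cvg_id|exact: cvg_cst]].
exact: (cvg_pair (aff _ _) (aff _ _)).
Qed.

Lemma convex_connected K : convex K -> connected K.
Proof.
move=> Kconv; have [[p Kp]|/forallNP K0] := pselect (exists p, K p); last first.
  suff -> : K = set0 by exact: connected0.
  by apply/seteqP; split=> // p /K0.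
have -> : K = \bigcup_(q in K) (between p q @` `[0, 1]).
  apply/seteqP; split=> [q Kq|_ [q Kq [t /= t01 <-]]].
    exists q => //; exists 1; first by rewrite /= in_itv /= ler01 lexx.
    by rewrite /between !mul1r ![_ + (_ - _)]addrC !subrK; case: q {Kq}.
  by apply: Kconv => //; rewrite in_itv in t01.
apply: bigcup_connected => [|q Kq].
  exists p => q Kq; exists 0; first by rewrite /= in_itv /= ler01 lexx.
  by rewrite /between !mul0r !addr0; case: (p).
apply: connected_continuous_connected; first exact: segment_connected.
exact/continuous_subspaceT/between_continuous.
Qed.

Lemma unit_disk_convex : convex (@unit_disk R).
Proof.
move=> [a b] [c d] t; rewrite /unit_disk /= => p1 q1 /andP[t0 t1].
(* One minus the squared norm of the intermediate point is the sum of the next three nonnegative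
   terms. *)
have h0 : 0 <= (t * (1 - t)) * ((a - c) ^+ 2 + (b - d) ^+ 2).
  by apply: mulr_ge0; [apply: mulr_ge0|apply: addr_ge0]; rewrite ?sqr_ge0 ?subr_ge0.
have h1 : 0 <= (1 - t) * (1 - (a ^+ 2 + b ^+ 2)) by rewrite mulr_ge0 ?subr_ge0.
have h2 : 0 <= t * (1 - (c ^+ 2 + d ^+ 2)) by rewrite mulr_ge0 ?subr_ge0.
rewrite -subr_ge0 [X in 0 <= X](_ : _ = (t * (1 - t)) * ((a - c) ^+ 2 + (b - d) ^+ 2)
  + (1 - t) * (1 - (a ^+ 2 + b ^+ 2)) + t * (1 - (c ^+ 2 + d ^+ 2))); last by ring.
by rewrite !addr_ge0.
Qed.

Lemma rectangle_convex : convex (@rectangle R).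
Proof.
move=> [a b] [c d] t; rewrite /rectangle /= !in_itv /=.
move=> [/andP[a0 a1] /andP[b0 b1]] [/andP[c0 c1] /andP[d0 d1]] /andP[t0 t1].
by split; apply/andP; split; nra.
Qed.

End PlaneTopology.

(** * Coordinates on the pieces and the quotient by the gluings *)

Section Pieces.
Variables (R : realType) (G : fatgraph).
Implicit Types (e : G) (c : piece G) (z w : piece G * (R * R)).

Definition valid z : Prop := @piece_shape R G z.1 z.2.

Lemma piece_shape_convex c : convex (@piece_shape R G c).
Proof.
by case: c => c; [exact: unit_disk_convex|exact: rectangle_convex|
  exact: unit_disk_convex].
Qed.

Definition point_of z (hz : valid z) : pieces R G :=
  existT _ z.1 (exist _ z.2 (mem_set hz)).

Lemma raw_point_of z (hz : valid z) : raw (point_of hz) = z.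
Proof. by case: z hz. Qed.

Lemma raw_inj : injective (@raw R G).
Proof.
move=> [c u] [c' v]; rewrite /raw /= => -[cc'].
by subst c' => uv; congr existT; exact: val_inj.
Qed.

Lemma raw_valid (a : pieces R G) : valid (raw a).
Proof. by case: a => c [p hp]; exact: set_mem. Qed.

Lemma openP_raw (P : set (piece G * (R * R))) :
  (forall c, open [set p | P (c, p)]) -> open (@raw R G @^-1` P).
Proof.
move=> Po; apply/sigT_openP => c; exists [set p | P (c, p)] => //.
Qed.

Lemma open_raw (U : set (pieces R G)) c : open U ->
  exists2 V : set (R * R), open V &
    forall a, (raw a).1 = c -> (U a <-> V (raw a).2).
Proof.
move=> /sigT_openP /(_ c)[V Vo VU]; exists V => // -[c' u] /= cc'.
subst c'; rewrite -[U _]/((existT _ c @^-1` U) u) -VU.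
by [].
Qed.

(** Induction on the equivalence closure: a property preserved by each single gluing descends to the
    surface. *)
Lemma pi_eq_ind (P : piece G * (R * R) -> Prop) :
  (forall z w, valid z -> valid w -> gluing z w -> P z <-> P w) ->
  forall a b, \pi_(surface R G) a = \pi_(surface R G) b -> P (raw a) <-> P (raw b).
Proof.
move=> Pglue a b /eqquotP /asboolP; elim=> //.
- by move=> u v uv; apply: Pglue => //; exact: raw_valid.
- by move=> u v _ ->.
- by move=> u v w _ -> _ ->.
Qed.

Lemma pi_gluing (a b : pieces R G) : gluing (raw a) (raw b) ->
  \pi_(surface R G) a = \pi_(surface R G) b.
Proof. by move=> ab; apply/eqquotP/asboolP; exact: rst_step. Qed.

Lemma cyc_of_eq (f : G -> G) (f_inj : injective f) e e' :
  fconnect f e e' -> cyc_of f_inj e = cyc_of f_inj e'.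
Proof.
by move=> ee'; apply: val_inj => /=; apply/fingraph.rootP => //; exact: fconnect_sym.
Qed.

Lemma cyc_ofK (f : G -> G) (f_inj : injective f) (c : cyc f) :
  cyc_of f_inj (val c) = c.
Proof. by apply: val_inj => /=; apply/eqP; exact: (valP c). Qed.

Lemma valid_disk_pt e (r t : R) : -1 <= r <= 1 -> valid (disk_pt e r t).
Proof.
move=> r1; rewrite /valid /= /unit_disk /= !exprMn -mulrDr cos2Dsin2 mulr1.
nra.
Qed.

Lemma valid_strip_pt e (s t : R) : 0 <= s <= 1 -> -1 <= t <= 1 ->
  valid (strip_pt e s t).
Proof.
move=> s01 t11; rewrite /valid /= /rectangle /=.
by case: ifP => _ /=; rewrite !in_itv /=; split; lra.
Qed.

Lemma valid_cap_pt e (u : R) : valid (cap_pt e u).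
Proof. by rewrite /valid /= /unit_disk /= !mul1r cos2Dsin2. Qed.

(** An orbit of an involution has no elements besides [e] and [erev e]. *)
Lemma froot_erev e : froot (@erev G) e = if froot (@erev G) e == e then e else erev e.
Proof.
case: ifPn => [/eqP//|ne].
move: ne; rewrite -(iter_findex (connect_root (frel (@erev G)) e)).
move: (findex _ _ _) => k.
have iter2 m : iter m (@erev G) e = if odd m then erev e else e.
  by elim: m => //= m ->; case: (odd m); rewrite /= ?erevK.
by rewrite iter2; case: (odd k); rewrite ?eqxx.
Qed.

End Pieces.

(** * Passages of a simple cycle through a vertex *)

Section Vertices.
Variable G : fatgraph.
Implicit Types e : G.

Lemma sim_sym e e' : sim e e' = sim e' e.
Proof. by rewrite !vrot_sim (fconnect_sym (@perm_inj _ (vrot G))). Qed.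

Lemma sim_trans e e' e'' : sim e e' -> sim e' e'' -> sim e e''.
Proof. by rewrite !vrot_sim; exact: connect_trans. Qed.

Lemma sim_vrot e : sim e (vrot G e).
Proof. by rewrite vrot_sim; exact: fconnect1. Qed.

Lemma degree_order e : degree e = fingraph.order (vrot G) e.
Proof. by apply: eq_card => e'; rewrite !inE vrot_sim. Qed.

Lemma iter_degree e : iter (degree e) (vrot G) e = e.
Proof. by rewrite degree_order iter_order//; exact: perm_inj. Qed.

Section Cycle.
Variables (n : nat) (x : 'I_n -> G).
Hypothesis xsimple : simple_cycle x.

Lemma card_vertex_out e : (#|[set e' | sim e e' & e' \in codom x]| <= 1)%N.
Proof.
have [_ _ xI _] := xsimple.
apply/card_le1_eqP => a b; rewrite !inE.
move=> /andP[ea /codomP[i ai]] /andP[eb /codomP[j bj]].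
rewrite ai bj; congr x; apply: xI; rewrite -ai -bj.
by rewrite sim_sym in eb; exact: sim_trans eb ea.
Qed.

(** The reverse of an edge of [x] starts where the next edge of [x] starts, so two such reverses at
    one vertex have the same successor index. *)
Lemma card_vertex_in e : (#|[set e' | sim e e' & erev e' \in codom x]| <= 1)%N.
Proof.
have [_ xE xI _] := xsimple.
apply/card_le1_eqP => a b; rewrite !inE.
move=> /andP[ea /codomP[i ai]] /andP[eb /codomP[j bj]].
apply: (can_inj (@erevK G)); rewrite ai bj; congr x.
apply: (can_inj (@ordSK n)); apply: xI.
have := xE i; have := xE j; rewrite -ai -bj !erevK => bS aS.
rewrite sim_sym in bS; apply: (sim_trans bS); apply: sim_trans aS.
by rewrite sim_sym in eb; exact: sim_trans eb ea.
Qed.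

End Cycle.
End Vertices.

(** * Degree four and the columns of the normal matrix *)

Section Columns.
Variables (G : fatgraph) (n : nat) (x y : 'I_n -> G).
Hypotheses (Gdec : decorated G) (xstd : standard_cycle x)
  (ystd : standard_cycle y) (xy : edge_disjoint_union x y).
Implicit Types e : G.

Let xsimple : simple_cycle x. Proof. by case: xstd. Qed.
Let ysimple : simple_cycle y. Proof. by case: ystd. Qed.

Lemma on_cycle_codom (z : 'I_n -> G) e :
  on_cycle z e -> (e \in codom z) || (erev e \in codom z).
Proof.
by move=> [i [->|->]]; rewrite ?erevK codom_f ?orbT.
Qed.

(** The edges at a vertex fall into four classes, in and out for each cycle, of at most one element
    each. The class of outgoing edges of [x] is left uncounted: degree at least 4 then forces it to
    be nonempty, so that [x] visits every vertex. *)
Lemma degree_le e : (degree e <= #|[set e' | sim e e' & e' \in codom x]| + 3)%N.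
Proof.
pose A (z : 'I_n -> G) := [set e' | sim e e' & e' \in codom z].
pose B (z : 'I_n -> G) := [set e' | sim e e' & erev e' \in codom z].
rewrite -/(A x); have Bx : (#|B x| <= 1)%N by exact: card_vertex_in.
have Ay : (#|A y| <= 1)%N by exact: card_vertex_out.
have By : (#|B y| <= 1)%N by exact: card_vertex_in.
have : (degree e <= #|A x :|: B x :|: A y :|: B y|)%N.
  apply/subset_leq_card/fintype.subsetP => e'; rewrite !inE => -> /=.
  have [/(_ e')[]/on_cycle_codom/orP[]-> _] := xy; by rewrite ?orbT.
have h1 := (leq_card_setU (A x :|: B x :|: A y) (B y)).1.
have h2 := (leq_card_setU (A x :|: B x) (A y)).1.
have h3 := (leq_card_setU (A x) (B x)).1.
lia.
Qed.

Lemma degree4 e : degree e = 4%N.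
Proof.
apply/eqP; rewrite eqn_leq; have [_ ->] := Gdec e; rewrite andbT.
apply: leq_trans (degree_le e) _.
have : (#|[set e' | sim e e' & e' \in codom x]| <= 1)%N.
  exact: card_vertex_out.
lia.
Qed.

Lemma vertex_ex e : exists i, sim (x i) e.
Proof.
have : (0 < #|[set e' | sim e e' & e' \in codom x]|)%N.
  by have := degree_le e; rewrite degree4; case: #|_|.
move=> /card_gt0P[e']; rewrite inE => /andP[ee' /codomP[i e'i]].
by exists i; rewrite -e'i sim_sym.
Qed.

(** A vertex is named by the index of the edge of [x] leaving it, which is its row in the normal
    matrix. *)
Definition vtx e : 'I_n := xchoose (vertex_ex e).

(* The column of e in the normal matrix of x. *)
Definition col e : nat := findex (vrot G) (x (vtx e)) e.

Lemma vtx_sim e : sim (x (vtx e)) e.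
Proof. exact: xchooseP (vertex_ex e). Qed.

Lemma vtx_eq i e : sim (x i) e -> vtx e = i.
Proof.
have [_ _ xI _] := xsimple.
move=> ie; apply: xI; rewrite sim_sym in ie.
exact: sim_trans (vtx_sim e) ie.
Qed.

Lemma iter4 e : iter 4 (vrot G) e = e.
Proof. by rewrite -{1}(degree4 e) iter_degree. Qed.

Lemma col_lt4 e : (col e < 4)%N.
Proof.
by rewrite -(degree4 (x (vtx e))) degree_order findex_max// -vrot_sim vtx_sim.
Qed.

Lemma colK e : iter (col e) (vrot G) (x (vtx e)) = e.
Proof. by rewrite iter_findex// -vrot_sim vtx_sim. Qed.

Lemma col_iter i k : (k < 4)%N -> col (iter k (vrot G) (x i)) = k.
Proof.
move=> k4; rewrite /col (@vtx_eq i) ?vrot_sim ?fconnect_iter//.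
by rewrite findex_iter// -degree_order degree4.
Qed.

Lemma vtx_iter i k : vtx (iter k (vrot G) (x i)) = i.
Proof. by rewrite (@vtx_eq i) ?vrot_sim ?fconnect_iter. Qed.

Lemma col_vrot e : col (vrot G e) = ((col e).+1 %% 4)%N.
Proof.
rewrite -{1}(colK e) -iterS; have := col_lt4 e.
rewrite leq_eqVlt => /predU1P[[->]|c]; last by rewrite col_iter// modn_small.
by rewrite iter4 (@col_iter _ 0).
Qed.

Lemma col_x i : col (x i) = 0%N. Proof. exact: (@col_iter i 0). Qed.

Lemma vtx_x i : vtx (x i) = i. Proof. exact: (@vtx_iter i 0). Qed.

(** In degree 4, opposite means two rotations apart, and two more rotations come back. *)
Lemma erev_xE i : erev (x i) = iter 2 (vrot G) (x (ordS i)).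
Proof.
by have [_ /(_ i)[_ ->]] := xstd; rewrite degree4 -iterD iter4.
Qed.

Lemma col_erev_x i : col (erev (x i)) = 2%N.
Proof. by rewrite erev_xE col_iter. Qed.

Lemma vtx_erev_x i : vtx (erev (x i)) = ordS i.
Proof. by rewrite erev_xE vtx_iter. Qed.

Lemma on_cycle_col e : on_cycle x e <-> ~~ odd (col e).
Proof.
split=> [[i [->|->]]|]; rewrite ?col_x ?col_erev_x//.
have := colK e; have := col_lt4 e.
case: (col e) => [|[|[|[]]]]//= _ <- _; first by exists (vtx e); left.
by exists (ord_pred (vtx e)); right; rewrite erev_xE ord_predK.
Qed.

Lemma on_cycle_erev (z : 'I_n -> G) e : on_cycle z (erev e) <-> on_cycle z e.
Proof.
split=> -[i [ei|ei]]; exists i.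
- by right; rewrite -ei erevK.
- by left; apply: (can_inj (@erevK G)).
- by right; rewrite ei.
- by left; rewrite ei erevK.
Qed.

Lemma odd_col_erev e : odd (col (erev e)) = odd (col e).
Proof.
apply: negb_inj; apply/idP/idP => /on_cycle_col h; apply/on_cycle_col;
  exact/on_cycle_erev.
Qed.

(** Reversal exchanges columns 0 and 2; the sum states both cases at once. *)
Lemma even_col_erev e : ~~ odd (col e) -> (col e + col (erev e) = 2)%N.
Proof.
by move=> /on_cycle_col[i [->|->]]; rewrite ?erevK col_x col_erev_x.
Qed.

Lemma in_column_normal (j : 'I_4) e : in_column (normal_matrix x) j e <-> col e = j.
Proof.
split=> [[i]|ej]; first by rewrite mxE => <-; rewrite col_iter.
by exists (vtx e); rewrite mxE -ej colK.
Qed.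

(** The odd columns hold the edges of [y]: column 1 leaves to the left of [x], column 3 to the
    right. *)
Definition same_side := forall e, odd (col e) -> col (erev e) = col e.

Lemma same_sideP : (forall i : 'I_n, exists j : 'I_4,
     in_column (normal_matrix x) j (y i) /\
     in_column (normal_matrix x) j (erev (y i))) <-> same_side.
Proof.
have yodd i : odd (col (y i)).
  apply/negPn/negP => /on_cycle_col yx; have [_ /(_ (y i))] := xy.
  by apply; split=> //; exists i; left.
split=> [h e oe|h i].
  have [/(_ e)[/on_cycle_col/negP[]//|[i ei]] _] := xy.
  have [j [/in_column_normal a /in_column_normal b]] := h i.
  by case: ei => ->; rewrite ?erevK a b.
exists (Ordinal (col_lt4 (y i))).
by split; apply/in_column_normal => //=; exact: h.
Qed.

(** * A signed function whose zero set is the curve *)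

Section SideFunction.
Variable R : realType.
Implicit Types (t : R) (z w : piece G * (R * R)).

Definition angle (k : nat) : R := 2 * pi * k%:R / 4.

Lemma angleD k l : angle (k + l) = angle k + angle l.
Proof. by rewrite /angle natrD; ring. Qed.

Lemma angle4M m : angle (4 * m) = pi *+ 2 *+ m.
Proof. by rewrite /angle natrM -[RHS]mulr_natr mulr2n; field. Qed.

Lemma cos_angle_modn k t : cos (angle (k %% 4) + t) = cos (angle k + t).
Proof.
rewrite [in RHS](divn_eq k 4) mulnC addnC angleD angle4M addrAC.
by rewrite (periodicn (@cosD2pi R)).
Qed.

Lemma sin_angle_modn k t : sin (angle (k %% 4) + t) = sin (angle k + t).
Proof.
rewrite [in RHS](divn_eq k 4) mulnC addnC angleD angle4M addrAC.
by rewrite (periodicn (@sinD2pi R)).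
Qed.

(** For odd columns, the side of [x] on which the edge leaves. For even columns, the sign that turns
    left of the edge into left of [x], since column 2 holds the reversed edges. *)
Definition side_sign (k : nat) : R := if (k < 2)%N then 1 else -1.

Lemma side_sign_neq0 k : side_sign k != 0.
Proof. by rewrite /side_sign; case: ifP; rewrite ?oppr_eq0 oner_eq0. Qed.

Lemma sin_angle k t : (k < 4)%N ->
  sin (angle k + t) = side_sign k * (if odd k then cos t else sin t).
Proof.
have angleS m : angle m.+1 = angle m + pi / 2 by rewrite /angle -natr1; field.
have angle0 : angle 0 = 0 by rewrite /angle mulr0 mul0r.
case: k => [|[|[|[]]]]//= _; rewrite /side_sign /= ?angleS angle0 ?add0r ?mul1r//.
- by rewrite addrC sinDpihalf.
- by rewrite addrC addrA sinDpihalf cosDpihalf mulN1r.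
- by rewrite addrC !addrA sinDpihalf cosDpihalf sinDpihalf mulN1r.
Qed.

(** The offset from the canonical edge of a vertex, where [disk_pt] starts measuring angles, to the
    edge of [x] there. *)
Definition base_pos e : nat := cyc_pos (vrot G) (x (vtx e)).

(** Strips of [y] get a constant sign, strips of [x] keep the transversal coordinate [u]. Caps use
    [u = -1] because a cap runs along the right of its edges. *)
Definition side_factor (k : nat) (u : R) : R :=
  side_sign k * (if odd k then 1 else u).

(* Positive on the left of x and negative on its right near the curve: a signed
   distance to the curve on disks and on the strips of x, constant elsewhere. *)
Definition side z : R :=
  match z.1 with
  | Disk c => z.2.2 * cos (angle (base_pos (val c)))
              - z.2.1 * sin (angle (base_pos (val c)))
  | Strip c => side_factor (col (val c)) z.2.2
  | Cap c => side_factor (col (val c)) (-1)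
  end.

Lemma vtx_root e : vtx (froot (vrot G) e) = vtx e.
Proof.
apply: vtx_eq; apply: sim_trans (vtx_sim e) _.
by rewrite vrot_sim connect_root.
Qed.

Lemma cyc_pos_iter k e :
  cyc_pos (vrot G) (iter k (vrot G) e) = ((cyc_pos (vrot G) e + k) %% 4)%N.
Proof.
have vI : injective (vrot G) by exact: perm_inj.
rewrite /cyc_pos; have -> : froot (vrot G) (iter k (vrot G) e) = froot (vrot G) e.
  by apply/esym/fingraph.rootP; [exact: fconnect_sym|exact: fconnect_iter].
set r := froot _ e; have re : fconnect (vrot G) r e.
  by rewrite fconnect_sym// connect_root.
rewrite -{1}(iter_findex re) -iterD addnC; move: (_ + k)%N => m.
rewrite [in LHS](divn_eq m 4) addnC iterD.
have -> : iter (m %/ 4 * 4) (vrot G) r = r.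
  by elim: (m %/ 4)%N => // q IH; rewrite mulSn iterD IH iter4.
by rewrite findex_iter// -degree_order degree4 ltn_mod.
Qed.

(** Angles are measured anew from the edge of [x]; the reduction modulo 4 disappears by periodicity
    of sine and cosine. *)
Lemma disk_ptE e r t : disk_pt e r t =
  (Disk (cyc_of (@perm_inj _ (vrot G)) (x (vtx e))),
   polar r (angle (base_pos e + col e) + t)).
Proof.
have ep : cyc_pos (vrot G) e = ((base_pos e + col e) %% 4)%N.
  by rewrite -{1}(colK e) cyc_pos_iter.
rewrite /disk_pt degree4 /polar -/(angle _) ep cos_angle_modn sin_angle_modn.
congr (Disk _, _); apply/esym/cyc_of_eq.
by rewrite -vrot_sim vtx_sim.
Qed.

Lemma side_disk_pt e r t : side (disk_pt e r t) =
  r * (side_sign (col e) * (if odd (col e) then cos t else sin t)).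
Proof.
rewrite disk_ptE /side /= /base_pos vtx_root vtx_x -sin_angle ?col_lt4//.
rewrite angleD -mulrA -mulrA -mulrBr -sinB; congr (_ * sin _); ring.
Qed.

Lemma col_root_even e : ~~ odd (col e) -> froot (@erev G) e != e ->
  side_sign (col (froot (@erev G) e)) = - side_sign (col e).
Proof.
move=> ev ne; rewrite froot_erev (negbTE ne) /side_sign.
have := even_col_erev ev; move: ev; have := col_lt4 e.
case: (col e) => [|[|[|[]]]]//= _ _.
  by rewrite add0n => ->.
by move=> /eqP; rewrite -[X in _ == X]addn0 eqn_add2l => /eqP->; rewrite opprK.
Qed.

Lemma odd_col_root e : odd (col (froot (@erev G) e)) = odd (col e).
Proof. by rewrite froot_erev; case: ifP => // _; exact: odd_col_erev. Qed.

(** If the canonical edge of the strip is [erev e], both the sign and the transversal coordinate are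
    negated, and the product is unchanged. *)
Lemma side_strip_pt_even e s t : ~~ odd (col e) ->
  side (strip_pt e s t) = side_sign (col e) * t.
Proof.
move=> ev; rewrite /side /= /side_factor odd_col_root (negbTE ev).
case: ifPn => /= [/eqP->//|ne].
by rewrite col_root_even// mulrNN.
Qed.

Lemma side_strip_pt_odd e s t : odd (col e) ->
  side (strip_pt e s t) = side_sign (col (froot (@erev G) e)).
Proof. by move=> oe; rewrite /side /= /side_factor odd_col_root oe mulr1. Qed.

Lemma core_side z : core x z -> side z = 0.
Proof.
move=> [e [s [/on_cycle_col ev s01 [->|->]]]].
  by rewrite side_strip_pt_even// mulr0.
by rewrite side_disk_pt (negbTE ev) sin0 !mulr0.
Qed.

(** On a disk the zero set is the diameter along [x], on a strip of [x] its middle line; strips of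
    [y] and caps have no zeros. *)
Lemma side_core z : valid z -> side z = 0 -> core x z.
Proof.
case: z => -[] c [p1 p2]; rewrite /valid /side /=.
- rewrite /unit_disk /= => p1p2.
  set a := angle _ => h0; pose e := x (vtx (val c)).
  pose s := p1 * cos a + p2 * sin a.
  have cs := cos2Dsin2 a.
  have es1 : p1 = s * cos a.
    rewrite -[LHS]mulr1 -cs /s; move: h0 => /eqP; rewrite subr_eq0 => /eqP h0.
    by rewrite mulrDr mulrDl; congr (_ + _); [ring|rewrite mulrAC h0; ring].
  have es2 : p2 = s * sin a.
    rewrite -[LHS]mulr1 -cs /s; move: h0 => /eqP; rewrite subr_eq0 => /eqP h0.
    by rewrite mulrDr mulrDl; congr (_ + _); [rewrite expr2 mulrA h0; ring|ring].
  have s1 : s ^+ 2 <= 1.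
    by move: p1p2; rewrite es1 es2 !exprMn -mulrDr cs mulr1.
  have cE : c = cyc_of (@perm_inj _ (vrot G)) e.
    rewrite -[LHS](cyc_ofK (@perm_inj _ (vrot G))); apply/esym/cyc_of_eq.
    by rewrite -vrot_sim vtx_sim.
  have [s0|s0] := leP 0 s.
    exists e, s; split; [by exists (vtx (val c)); left|by rewrite s0; nra|right].
    by rewrite disk_ptE /base_pos vtx_x col_x addn0 addr0 {1}cE es1 es2.
  (* The negative half of the diameter belongs to the opposite edge, in column 2. *)
  exists (iter 2 (vrot G) e), (- s); split.
  + by apply/on_cycle_col; rewrite col_iter.
  + by apply/andP; split; nra.
  have aE : angle (cyc_pos (vrot G) (x (vtx (val c))) + 2)%N = a + pi.
    by rewrite angleD; congr (_ + _); rewrite /angle; field.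
  right; rewrite disk_ptE /base_pos vtx_iter col_iter// addr0 aE {1}cE /polar.
  by rewrite sinDpi cosDpi !mulrNN es1 es2.
- rewrite /side_factor; case: ifPn => [_ _ /eqP|ev].
    by rewrite mulr1 (negbTE (side_sign_neq0 _)).
  rewrite /rectangle /= !in_itv /= => -[p01 _] /eqP.
  rewrite mulf_eq0 (negbTE (side_sign_neq0 _)) /= => /eqP->.
  exists (val c), p1; split => //; first exact/on_cycle_col.
  by left; rewrite /strip_pt cyc_ofK ifT//; exact: (valP c).
- move=> _ /eqP; rewrite /side_factor mulf_eq0 (negbTE (side_sign_neq0 _)) /=.
  by case: ifP; rewrite ?oppr_eq0 oner_eq0.
Qed.

Lemma sg_side_sign k : Num.sg (side_sign k) = side_sign k.
Proof. by rewrite /side_sign; case: ifP; rewrite ?sgrN sgr1. Qed.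

(** The glued arc stays within [pi / 8] of the direction of [e], where sine has the sign of its
    argument. *)
Lemma sg_side_disk_even e t : ~~ odd (col e) -> -1 <= t <= 1 ->
  Num.sg (side (disk_pt e 1 (t * (pi / (2 * 4%:R))))) = side_sign (col e) * Num.sg t.
Proof.
move=> ev t1; rewrite side_disk_pt mul1r (negbTE ev) sgrM sg_side_sign.
congr (_ * _); have p0 := pi_gt0 R.
have sin_gt0 (u : R) : 0 < u <= 1 -> 0 < sin (u * (pi / (2 * 4%:R))).
  move=> /andP[u0 u1]; have up : 0 < u * pi by exact: mulr_gt0 u0 p0.
  have : 0 <= (1 - u) * pi by rewrite mulr_ge0 ?subr_ge0// ltW.
  by rewrite mulrBl mul1r => up1; apply: sin_gt0_pihalf; rewrite mulrA; lra.
have [t0|t0|->] := ltrgt0P t.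
- by rewrite !gtr0_sg// sin_gt0; lra.
- have Nt : 0 < - t by rewrite oppr_gt0.
  have sp : 0 < sin (- t * (pi / (2 * 4%:R))) by apply: sin_gt0; lra.
  by rewrite (ltr0_sg t0) -[t]opprK mulNr sinN sgrN (gtr0_sg sp).
- by rewrite mul0r sin0 !sgr0.
Qed.

Lemma sg_side_disk_odd e t : odd (col e) -> -1 <= t <= 1 ->
  Num.sg (side (disk_pt e 1 (t * (pi / (2 * 4%:R))))) = side_sign (col e).
Proof.
move=> oe t1; rewrite side_disk_pt mul1r oe sgrM sg_side_sign gtr0_sg ?mulr1//.
by apply: cos_gt0_pihalf; have p0 := pi_gt0 R; nra.
Qed.

(** The free arc runs from [pi / 8] to [3 pi / 8], where sine and cosine are both positive. *)
Lemma sg_side_disk_free e s : 0 <= s <= 1 ->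
  Num.sg (side (disk_pt e 1 ((1 + 2 * s) * (pi / (2 * 4%:R))))) = side_sign (col e).
Proof.
move=> s1; rewrite side_disk_pt mul1r sgrM sg_side_sign gtr0_sg ?mulr1//.
have p0 := pi_gt0 R.
by case: ifP => _; [apply: cos_gt0_pihalf|apply: sin_gt0_pihalf]; nra.
Qed.

Lemma side_cap_pt_neq0 e t : side (cap_pt e t) != 0.
Proof.
rewrite /side /= /side_factor mulf_neq0 ?side_sign_neq0//.
by case: ifP; rewrite ?oppr_eq0 oner_eq0.
Qed.

(** Signs can disagree across a gluing when an edge of [y] changes sides, but the zero set always
    matches, so it descends to the surface. *)
Lemma gluing_side_eq0 z w : gluing z w -> side z = 0 <-> side w = 0.
Proof.
case=> [e t t1|e s s01|e s s01]; rewrite ?degree4.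
- have [oe|ev] := boolP (odd (col e)).
    have := sg_side_disk_odd oe t1; rewrite side_strip_pt_odd//.
    move=> sgE; split=> /eqP; first by rewrite (negbTE (side_sign_neq0 _)).
    by rewrite -sgr_eq0 sgE (negbTE (side_sign_neq0 _)).
  have := sg_side_disk_even ev t1; rewrite side_strip_pt_even// => sgE.
  split=> [/eqP|/eqP].
    rewrite mulf_eq0 (negbTE (side_sign_neq0 _)) /= => /eqP t0.
    by apply/eqP; rewrite -sgr_eq0 sgE t0 sgr0 mulr0.
  rewrite -sgr_eq0 sgE mulf_eq0 (negbTE (side_sign_neq0 _)) /= sgr_eq0.
  by move=> /eqP->; rewrite mulr0.
- split=> /eqP; first by rewrite (negbTE (side_cap_pt_neq0 _ _)).
  have [oe|ev] := boolP (odd (col e)).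
    by rewrite side_strip_pt_odd// (negbTE (side_sign_neq0 _)).
  by rewrite side_strip_pt_even// mulrN1 oppr_eq0 (negbTE (side_sign_neq0 _)).
- split=> /eqP; first by rewrite (negbTE (side_cap_pt_neq0 _ _)).
  by rewrite -sgr_eq0 sg_side_disk_free// (negbTE (side_sign_neq0 _)).
Qed.

Lemma pi_side_eq0 (a b : pieces R G) :
  \pi_(surface R G) a = \pi_(surface R G) b -> side (raw a) = 0 <-> side (raw b) = 0.
Proof.
by apply: (@pi_eq_ind R G (fun z => side z = 0)) => z w _ _; exact: gluing_side_eq0.
Qed.

Lemma curve_side (a : pieces R G) :
  curve x (\pi_(surface R G) a) <-> side (raw a) = 0.
Proof.
split=> [[b /core_side b0 ba]|a0]; first exact/(pi_side_eq0 ba).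
by exists a => //; apply: side_core => //; exact: raw_valid.
Qed.

(** Under [same_side], [bnd] exchanges columns 1 and 2, and columns 0 and 3. A boundary component
    thus stays on the left of [x] in the first case and on the right in the second. *)
Lemma bnd_col e : same_side -> forall e', fconnect (@bnd G) e e' ->
  side_factor (col e') (-1) = side_factor (col e) (-1).
Proof.
move=> ss e' /iter_findex <-; elim: (findex _ _ _) => //= m <-.
move: (iter _ _ _) => {}e; rewrite /bnd col_vrot /side_factor /side_sign.
have := col_lt4 e; have [oe|ev] := boolP (odd (col e)).
  by rewrite ss//; move: oe; case: (col e) => [|[|[|[]]]]//= _ _;
    rewrite ?mulrNN ?mul1r ?mulr1.
have := even_col_erev ev; move: ev.
case: (col e) => [|[|[|[]]]]//= _.
  by rewrite add0n => -> _ /=; rewrite !mulr1 !mul1r.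
move=> /eqP; rewrite -[X in _ == X]addn0 eqn_add2l => /eqP-> _ /=.
by rewrite mulrNN !mulr1.
Qed.

Lemma side_sign_root e : same_side -> odd (col e) ->
  side_sign (col (froot (@erev G) e)) = side_sign (col e).
Proof. by move=> ss oe; rewrite froot_erev; case: ifP => // _; rewrite ss. Qed.

Lemma side_cap_pt e t : same_side -> side (cap_pt e t) = side_factor (col e) (-1).
Proof.
by move=> ss; apply: bnd_col => //; exact: connect_root.
Qed.

Lemma gluing_sg_side z w : same_side -> gluing z w ->
  Num.sg (side z) = Num.sg (side w).
Proof.
move=> ss; case=> [e t t1|e s s01|e s s01]; rewrite ?degree4 ?side_cap_pt//.
- have [oe|ev] := boolP (odd (col e)).
    by rewrite sg_side_disk_odd// side_strip_pt_odd// side_sign_root// sg_side_sign.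
  by rewrite sg_side_disk_even// side_strip_pt_even// sgrM sg_side_sign.
- rewrite /side_factor; have [oe|ev] := boolP (odd (col e)).
    by rewrite side_strip_pt_odd// side_sign_root// mulr1.
  by rewrite side_strip_pt_even.
- rewrite sg_side_disk_free// /side_factor; have [oe|ev] := boolP (odd (col e)).
    by rewrite ss// mulr1 sg_side_sign.
  have := even_col_erev ev; have := col_lt4 e; move: ev.
  rewrite sgrM sg_side_sign /side_sign; case: (col e) => [|[|[|[]]]]//= _ _.
    by rewrite add0n => ->; rewrite sgrN sgr1 mul1r.
  move=> /eqP; rewrite -[X in _ == X]addn0 eqn_add2l => /eqP->.
  by rewrite sgrN sgr1 mulrNN mulr1.
Qed.

Lemma side_continuous c : continuous (fun p : R * R => side (c, p)).
Proof.
case: c => c; rewrite /side /=.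
- move=> p; apply: cvgB; apply: cvgM; try exact: cvg_cst.
    exact: cvg_snd.
  exact: cvg_fst.
- rewrite /side_factor => p; apply: cvgM; first exact: cvg_cst.
  by case: ifP => _; [exact: cvg_cst|exact: cvg_snd].
- by move=> p; exact: cvg_cst.
Qed.

(** [side] is affine on each piece, so the points of a piece with a given sign form a convex set. *)
Lemma side_between c p q t :
  side (c, between p q t) = (1 - t) * side (c, p) + t * side (c, q).
Proof.
rewrite /side /between /=; case: c => c; first by ring.
  by rewrite /side_factor; case: ifP => _; ring.
by ring.
Qed.


(** * Matching sides give a separating curve *)

Lemma same_side_separating : (0 < n)%N -> same_side -> separating R x.
Proof.
move=> n0 ss conn.
pose P (s : R) := [set u : surface R G |
  exists2 a, \pi_(surface R G) a = u & 0 < s * side (raw a)].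
have Ppi s a : P s (\pi_(surface R G) a) <-> 0 < s * side (raw a).
  split=> [[b ba]|]; last by move=> sa; exists a.
  rewrite -sgr_cp0 -[_ < s * _]sgr_cp0 !sgrM.
  suff -> : Num.sg (side (raw a)) = Num.sg (side (raw b)) by [].
  have glue z w : valid z -> valid w -> gluing z w ->
      Num.sg (side z) = Num.sg (side (raw b)) <->
      Num.sg (side w) = Num.sg (side (raw b)).
    by move=> _ _ /(gluing_sg_side ss) ->.
  by have [h _] := pi_eq_ind glue ba; rewrite h.
have Popen s : open (P s).
  suff: open (\pi_(surface R G) @^-1` P s) by [].
  have -> : \pi_(surface R G) @^-1` P s = @raw R G @^-1` [set z | 0 < s * side z].
    by apply/seteqP; split=> a /=; rewrite Ppi.
  apply: openP_raw => c.
  have cts : continuous (fun p => s * side (c, p)).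
    by move=> p; apply: cvgM; [exact: cvg_cst|exact: side_continuous].
  by apply: (open_comp _ (@open_gt R 0)) => p _; exact: cts.
pose e := x (Ordinal n0).
have valid_e t : valid (disk_pt e (1 : R) t) by apply: valid_disk_pt; lra.
have side_e t : side (raw (point_of (valid_e t))) = sin t.
  by rewrite raw_point_of side_disk_pt col_x /= !mul1r.
have PN : P 1 !=set0.
  exists (\pi_(surface R G) (point_of (valid_e (pi / 2)))); apply/Ppi.
  by rewrite side_e sin_pihalf mul1r.
(* The next two facts make the left side relatively open and relatively closed: off the curve it is
   the complement of the open right side. *)
have PE : P 1 = ~` curve x `&` P 1.
  rewrite setIidr// => u [a <-]; rewrite mul1r => a0 /curve_side a00.
  by rewrite a00 ltxx in a0.
have PC : P 1 = ~` curve x `&` ~` P (-1).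
  apply/seteqP; split=> u; rewrite -[u]reprK /=.
    move=> /Ppi; rewrite mul1r => u0; split.
      by move=> /curve_side u1; rewrite u1 ltxx in u0.
    by move=> /Ppi; lra.
  move=> [/curve_side/eqP u0 /Ppi]; rewrite mulN1r oppr_gt0 => u1.
  apply/Ppi; rewrite mul1r lt_neqAle eq_sym u0 /=.
  by rewrite leNgt; exact/negP.
have P1E := conn (P 1) PN (ex_intro2 _ _ _ (Popen 1) PE)
  (ex_intro2 _ _ _ (open_closedC (Popen (-1))) PC).
(* By connectedness the left side would contain the point at angle [- (pi / 2)], which is on the
   right. *)
have : P 1 (\pi_(surface R G) (point_of (valid_e (- (pi / 2))))).
  rewrite P1E => /curve_side; rewrite side_e sinN sin_pihalf; lra.
move=> /Ppi; rewrite side_e sinN sin_pihalf; lra.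
Qed.

(** * Relatively clopen subsets of the complement of the curve *)

Section Connected.
Variables (B : set (surface R G)) (C D : set (surface R G)).
Hypotheses (Copen : open C) (BC : B = ~` curve x `&` C)
  (Dclosed : closed D) (BD : B = ~` curve x `&` D).

(** Membership in [B] read on coordinates, to be carried along gluings and inside pieces. *)
Definition inB z : Prop := exists2 a : pieces R G,
  raw a = z & B (\pi_(surface R G) a).

Lemma inB_raw (a : pieces R G) : inB (raw a) <-> B (\pi_(surface R G) a).
Proof. by split=> [[b /raw_inj->]|]; last by move=> Ba; exists a. Qed.

Lemma inB_gluing z w : valid z -> valid w -> gluing z w -> inB z <-> inB w.
Proof.
move=> vz vw zw; rewrite -(raw_point_of vz) -(raw_point_of vw) !inB_raw.
by rewrite (@pi_gluing R G (point_of vz) (point_of vw)) ?raw_point_of.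
Qed.

(** The part [K] of the piece on the side of [p] is convex, hence connected, and [B] has a clopen
    trace on it containing [p]. *)
Lemma inB_region c p q : valid (c, p) -> valid (c, q) ->
  0 < side (c, p) * side (c, q) -> inB (c, p) -> inB (c, q).
Proof.
move=> vp vq pq Bp; pose s := side (c, p).
pose K := [set r | valid (c, r) /\ 0 < s * side (c, r)].
have Kconv : convex K.
  move=> a b t [va sa] [vb sb] t01; split.
    by apply: (@piece_shape_convex R G c a b t).
  rewrite side_between; move: t01 => /andP[t0 t1].
  have [->|t0'] := eqVneq t 0; first by rewrite subr0 mul1r mul0r addr0.
  rewrite mulrDr ltr_wpDl//.
    by rewrite mulrCA mulr_ge0 ?subr_ge0// ltW.
  by rewrite mulrCA mulr_gt0// lt_neqAle eq_sym t0'.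
(* [side] does not vanish on [K], so [K] avoids the curve, and there [B] agrees with both [C] and
   [D]. *)
have KB r (Kr : K r) (E : set (surface R G)) : B = ~` curve x `&` E ->
    inB (c, r) <-> E (\pi_(surface R G) (point_of Kr.1)).
  move=> BE; rewrite -{1}(raw_point_of Kr.1) inB_raw BE; split=> [[]//|Er].
  split=> // /curve_side; rewrite raw_point_of => r0.
  by case: Kr {Er} => ? /=; rewrite r0 mulr0 ltxx.
have relopen (E : set (surface R G)) : open E ->
    exists2 V : set (R * R), open V & forall r (Kr : K r),
      E (\pi_(surface R G) (point_of Kr.1)) <-> V r.
  move=> Eo; have Eo' : open (\pi_(surface R G) @^-1` E) by [].
  have [V Vo VE] := open_raw c Eo'; exists V => // r Kr.
  by apply: iff_trans (VE (point_of Kr.1) _) _.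
have ss0 : s != 0 by apply: contraTneq pq => s0; rewrite -/s s0 mul0r ltxx.
have Kp : K p by split=> //; rewrite -expr2 exprn_even_gt0.
have Kq : K q by [].
have [V Vo VC] := relopen C Copen.
have [W Wo WD] := relopen (~` D) (closed_openC Dclosed).
have KVE : K `&` V = K.
  apply: (convex_connected Kconv).
  - by exists p; split => //; apply/(VC _ Kp)/(KB _ Kp _ BC).
  - by exists V.
  - exists (~` W); first exact: open_closedC.
    apply/seteqP; split=> r [Kr h]; split=> //.
      move=> /(WD _ Kr) /=; apply.
      by apply/(KB _ Kr _ BD)/(KB _ Kr _ BC)/(VC _ Kr).
    apply/(VC _ Kr)/(KB _ Kr _ BC)/(KB _ Kr _ BD).
    by apply: contrapT => nD; apply: h; apply/(WD _ Kr).
apply/(KB _ Kq _ BC)/(VC _ Kq).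
by have : K q by []; rewrite -KVE => -[].
Qed.

Lemma inB_same_region z w : valid z -> valid w -> z.1 = w.1 ->
  0 < side z * side w -> inB z <-> inB w.
Proof.
move: z w => [c p] [c' q] /= vp vq cc'; subst c' => pq.
by split; apply: inB_region => //; rewrite mulrC.
Qed.

Definition left_pt i : piece G * (R * R) := disk_pt (x i) 1 (pi / 2).
Definition right_pt i : piece G * (R * R) := disk_pt (x i) 1 (- (pi / 2)).
Definition side_pt i (s : R) := if 0 < s then left_pt i else right_pt i.

Lemma inB_disk e t : side (disk_pt e 1 t) != 0 ->
  inB (disk_pt e 1 t) <-> inB (side_pt (vtx e) (side (disk_pt e 1 t))).
Proof.
move=> s0; apply: inB_same_region.
- by apply: valid_disk_pt; lra.
- by rewrite /side_pt; case: ifP => _; apply: valid_disk_pt; lra.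
- by rewrite /side_pt; case: ifP => _; rewrite /left_pt /right_pt !disk_ptE vtx_x.
- rewrite /side_pt; case: ifPn => sp; rewrite [X in _ * X]side_disk_pt col_x /= !mul1r.
    by rewrite sin_pihalf mulr1.
  by rewrite sinN sin_pihalf mulrN1 oppr_gt0 lt_neqAle s0 leNgt.
Qed.

Lemma side_pt_sg i s : side_pt i (Num.sg s) = side_pt i s.
Proof. by rewrite /side_pt sgr_gt0. Qed.

Lemma inB_strip_even e t : ~~ odd (col e) -> -1 <= t <= 1 -> t != 0 ->
  inB (strip_pt e 0 t) <-> inB (side_pt (vtx e) (side_sign (col e) * t)).
Proof.
move=> ev t1 t0; apply: iff_trans.
  apply: inB_gluing; [by apply: valid_strip_pt => //; lra| |exact: glue_strip_disk].
  by apply: valid_disk_pt; lra.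
rewrite degree4; have sgE := sg_side_disk_even ev t1.
apply: iff_trans; first apply: inB_disk.
  by rewrite -sgr_eq0 sgE mulf_neq0 ?side_sign_neq0// sgr_eq0.
by rewrite -side_pt_sg sgE -[in X in _ <-> X]side_pt_sg sgrM sg_side_sign.
Qed.

Lemma inB_strip_odd e : odd (col e) ->
  inB (strip_pt e 0 0) <-> inB (side_pt (vtx e) (side_sign (col e))).
Proof.
move=> oe; have t1 : -1 <= (0 : R) <= 1 by lra.
apply: iff_trans.
  apply: inB_gluing; [by apply: valid_strip_pt => //; lra| |exact: glue_strip_disk].
  by apply: valid_disk_pt; lra.
rewrite degree4; have sgE := sg_side_disk_odd oe t1.
apply: iff_trans; first apply: inB_disk.
  by rewrite -sgr_eq0 sgE side_sign_neq0.
by rewrite -side_pt_sg sgE.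
Qed.

Lemma strip_pt_erev1 e s t s' t' :
  (strip_pt (R := R) e s t).1 = (strip_pt (erev e) s' t').1.
Proof. by congr Strip; apply: cyc_of_eq; exact: fconnect1. Qed.

(** A half-strip of [x i] joins half-disks at both ends. At the far end it is read from
    [erev (x i)], in column 2, where the change of sign cancels that of the transversal
    coordinate. *)
Lemma inB_next i s : s != 0 -> inB (side_pt i s) <-> inB (side_pt (ordS i) s).
Proof.
(* Replacing [s] by its sign makes it a valid transversal coordinate. *)
move=> s0; rewrite -side_pt_sg -[in X in _ <-> X]side_pt_sg; set u := Num.sg s.
have u1 : -1 <= u <= 1 by rewrite /u; case: sgrP => _; lra.
have u0 : u != 0 by rewrite sgr_eq0.
have ev : ~~ odd (col (x i)) by rewrite col_x.
have ev' : ~~ odd (col (erev (x i))) by rewrite col_erev_x.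
have h1 := inB_strip_even ev u1 u0.
have Nu1 : -1 <= - u <= 1 by lra.
have Nu0 : - u != 0 by rewrite oppr_eq0.
have h2 := inB_strip_even ev' Nu1 Nu0.
rewrite col_x vtx_x /side_sign /= mul1r in h1.
rewrite col_erev_x vtx_erev_x /side_sign /= mulrNN mul1r in h2.
apply: iff_trans (iff_sym h1) _; apply: iff_trans h2.
apply: inB_same_region; try by apply: valid_strip_pt; lra.
  exact: strip_pt_erev1.
rewrite !side_strip_pt_even// col_x col_erev_x /side_sign /= mul1r mulrNN mul1r.
by rewrite -expr2 exprn_even_gt0.
Qed.

Lemma inB_same_sign i j s : s != 0 -> inB (side_pt i s) <-> inB (side_pt j s).
Proof.
move=> s0; have n0 : (0 < n)%N by case: (n) i => [[]|].
suff to0 k (kn : (k < n)%N) :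
    inB (side_pt (Ordinal n0) s) <-> inB (side_pt (Ordinal kn) s).
  case: i j => i hi [j hj]; apply: iff_trans (to0 _ _).
  exact: iff_sym.
elim: k kn => [|k IH] kn.
  by rewrite (_ : Ordinal kn = Ordinal n0)//; exact: val_inj.
have kn' : (k < n)%N by exact: ltnW.
apply: iff_trans (IH kn') _; apply: iff_trans (inB_next _ s0) _.
by rewrite (_ : ordS _ = Ordinal kn)//; apply: val_inj; rewrite /= modn_small.
Qed.

Lemma inB_strips e s t s' t' : valid (strip_pt e s t) -> valid (strip_pt e s' t') ->
  odd (col e) -> inB (strip_pt e s t) <-> inB (strip_pt e s' t').
Proof.
move=> v v' oe; apply: inB_same_region => //.
by rewrite !side_strip_pt_odd// -expr2 exprn_even_gt0//= side_sign_neq0.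
Qed.

(** Some edge of [y] has its two ends in columns 1 and 3, and [side] is constant on its strip, which
    therefore joins a left half-disk to a right one. *)
Lemma inB_left_right i j : ~ same_side -> inB (side_pt i 1) <-> inB (side_pt j (-1)).
Proof.
move=> /existsNP[e /not_implyP[oe /eqP ne]].
have oe' : odd (col (erev e)) by rewrite odd_col_erev.
have h : inB (side_pt (vtx e) (side_sign (col e))) <->
    inB (side_pt (vtx (erev e)) (side_sign (col (erev e)))).
  apply: iff_trans (iff_sym (inB_strip_odd oe)) _.
  apply: iff_trans (inB_strip_odd oe').
  apply: inB_same_region; try by apply: valid_strip_pt; lra.
    exact: strip_pt_erev1.
  rewrite !side_strip_pt_odd//.
  have -> : froot (@erev G) (erev e) = froot (@erev G) e.
    apply/esym/fingraph.rootP; last exact: fconnect1.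
    by apply: fconnect_sym; exact: erev_inj.
  by rewrite -expr2 exprn_even_gt0//= side_sign_neq0.
have n1 : (-1 : R) != 0 by rewrite oppr_eq0 oner_eq0.
have p1 : (1 : R) != 0 by rewrite oner_eq0.
move: h ne oe oe'; have := col_lt4 e; have := col_lt4 (erev e); rewrite /side_sign.
case: (col e) => [|[|[|[]]]]//; case: (col (erev e)) => [|[|[|[]]]]//= _ _ h _ _ _.
  by apply: iff_trans (inB_same_sign _ _ p1) _; apply: iff_trans h (inB_same_sign _ _ n1).
by apply: iff_trans (inB_same_sign _ _ p1) _; apply: iff_trans (iff_sym h) (inB_same_sign _ _ n1).
Qed.

Lemma inB_side_pt i j s t : ~ same_side -> s != 0 -> t != 0 ->
  inB (side_pt i s) <-> inB (side_pt j t).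
Proof.
have n1 : (-1 : R) != 0 by rewrite oppr_eq0 oner_eq0.
have p1 : (1 : R) != 0 by rewrite oner_eq0.
move=> nss; rewrite -side_pt_sg -[in X in _ -> _ -> _ <-> X]side_pt_sg.
case: sgrP => // _; case: sgrP => // _ _ _.
- exact: inB_same_sign.
- exact: inB_left_right.
- by apply: iff_sym; exact: inB_left_right.
- exact: inB_same_sign.
Qed.

(** A disk point is already in a half-disk, a strip leads to the disk at its initial end, and a cap
    leads to the strip of one of its edges. *)
Lemma inB_reach z : valid z -> side z != 0 ->
  exists i s, s != 0 /\ (inB z <-> inB (side_pt i s)).
Proof.
have strip_reach e s t : valid (strip_pt e s t) -> side (strip_pt e s t) != 0 ->
    exists i s', s' != 0 /\ (inB (strip_pt e s t) <-> inB (side_pt i s')).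
  move=> v h0; have [oe|ev] := boolP (odd (col e)).
    exists (vtx e), (side_sign (col e)); split; first exact: side_sign_neq0.
    apply: iff_trans (inB_strip_odd oe).
    by apply: inB_strips => //; apply: valid_strip_pt; lra.
  pose u := Num.sg t.
  have t0 : t != 0.
    by move: h0; rewrite side_strip_pt_even// mulf_eq0 negb_or => /andP[].
  have u1 : -1 <= u <= 1 by rewrite /u; case: sgrP => _; lra.
  have u0 : u != 0 by rewrite sgr_eq0.
  exists (vtx e), (side_sign (col e) * u); split.
    by rewrite mulf_neq0 ?side_sign_neq0.
  apply: iff_trans (inB_strip_even ev u1 u0).
  apply: inB_same_region => //; first by apply: valid_strip_pt; lra.
  rewrite !side_strip_pt_even// mulrACA -expr2 mulr_gt0//.
    by rewrite exprn_even_gt0//= side_sign_neq0.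
  by rewrite mulrC /u -normrEsg normr_gt0.
case: z => -[] c p vz h0.
- exists (vtx (val c)), (side (Disk c, p)); split=> //.
  apply: inB_same_region => //.
  + by rewrite /side_pt; case: ifP => _; apply: valid_disk_pt; lra.
  + rewrite /side_pt; case: ifP => _; rewrite /left_pt /right_pt !disk_ptE vtx_x /=;
      congr Disk; rewrite -[LHS](cyc_ofK (@perm_inj _ (vrot G)));
      by apply/esym/cyc_of_eq; rewrite -vrot_sim vtx_sim.
  + rewrite /side_pt; case: ifPn => sp; rewrite [X in _ * X]side_disk_pt col_x /= !mul1r.
      by rewrite sin_pihalf mulr1.
    by rewrite sinN sin_pihalf mulrN1 oppr_gt0 lt_neqAle h0 leNgt.
- have zE : (Strip c, p) = strip_pt (val c) p.1 p.2.
    by rewrite /strip_pt cyc_ofK ifT; [case: p {vz h0}|exact: (valP c)].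
  by rewrite zE; apply: strip_reach; rewrite -zE.
- pose e := val c; have v0 : 0 <= (0 : R) <= 1 by lra.
  have vs : valid (strip_pt e (0 : R) (-1)) by apply: valid_strip_pt; lra.
  (* This point is glued to a cap, where [side] has no zeros. *)
  have hs : side (strip_pt e 0 (-1)) != 0.
    apply/eqP => /(gluing_side_eq0 (glue_cap_strip e v0)) /eqP.
    by rewrite (negbTE (side_cap_pt_neq0 _ _)).
  have [i [s [s0 hi]]] := strip_reach _ _ _ vs hs.
  exists i, s; split=> //; apply: iff_trans hi.
  apply: iff_trans (inB_gluing (valid_cap_pt _ _) vs (glue_cap_strip e v0)).
  apply: inB_same_region => //; first exact: valid_cap_pt.
    by rewrite /= cyc_ofK.
  have -> : side (cap_pt e (0 / 2)) = side (Cap c, p) by rewrite /cap_pt cyc_ofK.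
  by rewrite -expr2 exprn_even_gt0.
Qed.

Lemma clopen_full : ~ same_side -> B !=set0 -> B = ~` curve x.
Proof.
move=> nss [u Bu]; apply/seteqP; split; first by rewrite BC => ? [].
move=> v; rewrite -[v]reprK -[u]reprK in Bu * => /curve_side/eqP v0.
have /curve_side/eqP u0 : ~ curve x (\pi_(surface R G) (repr u)).
  by move: Bu; rewrite BC => -[].
have [i [s [s0 /iffLR hu]]] := inB_reach (raw_valid (repr u)) u0.
have [j [t [t0 /iffRL hv]]] := inB_reach (raw_valid (repr v)) v0.
by apply/inB_raw/hv/(inB_side_pt i _ nss s0 t0)/hu/inB_raw.
Qed.

End Connected.

Lemma separating_same_side : separating R x -> same_side.
Proof.
move=> sep; apply: contrapT => nss; apply: sep => B B0 [C Co BC] [D Dc BD].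
exact: clopen_full Co BC Dc BD nss B0.
Qed.

End SideFunction.

End Columns.

Theorem theorem3p2 (R : realType) (G : fatgraph) (n : nat) (x y : 'I_n -> G) :
  decorated G -> standard_cycle x -> standard_cycle y ->
  edge_disjoint_union x y ->
  separating R x <->
  (forall i : 'I_n, exists j : 'I_4,
     in_column (normal_matrix x) j (y i) /\
     in_column (normal_matrix x) j (erev (y i))).
Proof.
move=> Gdec xstd ystd xy; have n0 : (0 < n)%N by case: xstd => -[].
rewrite (same_sideP Gdec xstd ystd xy); split.
  exact: separating_same_side.
exact: same_side_separating.
Qed.
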